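(* Let $S$ be a (discrete, infinite) holomorphic semigroup and let $\beta S$ be the space of all ultrafilters on $S$, with its Stone topology and the convolution $\star$. For a fixed $\mathscr{E}\in\beta S$, the function $F_{\mathscr{F}}(\mathscr{E})=\mathscr{E}\star\mathscr{F}$ is a continuous self-map of $\beta S$ for any $\mathscr{F}\in\beta S$. Here $F_{\mathscr{F}}$ denotes the translation map with respect to $\mathscr{F}$, sending $\mathscr{E}$ to $\mathscr{E}\star\mathscr{F}$.
   Context: A holomorphic semigroup $S$ is a semigroup, under functional composition $\circ$, of holomorphic functions defined on $\mathbb{C}$, on the Riemann sphere $\mathbb{C}_\infty$, or on certain subsets thereof. It is assumed to be discrete (as opposed to a continuous semigroup, such as a flow indexed by real parameters) and infinite. A filter on $S$ is a family $\mathscr{F}$ of non-empty subsets of $S$ such that $\emptyset\notin\mathscr{F}$; $A\in\mathscr{F}$ and $A\subset B$ imply $B\in\mathscr{F}$; and $A,B\in\mathscr{F}$ imply $A\cap B\in\mathscr{F}$. A filter $\mathscr{F}$ is an ultrafilter if for every $E\subset S$ either $E\in\mathscr{F}$ or $S-E\in\mathscr{F}$. $\beta S$ is the set of all ultrafilters on $S$, with the Stone topology, whose basis consists of the sets $\overline{A}=\{\mathscr{F}\in\beta S: A\in\mathscr{F}\}$, $A\subseteq S$. For $A\subset S$ and $f\in S$, put $A\circ f=\{g\in S: g\circ f\in A\}$. For $\mathscr{E},\mathscr{F}\in\beta S$, the convolution is $\mathscr{E}\star\mathscr{F}=\{A\subseteq S:\{f\in S: A\circ f\in\mathscr{E}\}\in\mathscr{F}\}$,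 which is again an ultrafilter on $S$. The map $F_{\mathscr{F}}$ is the analogue on $\beta S$ of the right translation map $F_g:S\to S$, $F_g(h)=h\circ g$, for $g\in S$. *)

(* Defs.v *)
From HB Require Import structures.
From mathcomp Require Import all_boot all_order all_algebra.
From mathcomp Require Import all_classical all_reals all_analysis.
From mathcomp Require Import complex.

Set Implicit Arguments.
Unset Strict Implicit.
Unset Printing Implicit Defensive.

Import Order.TTheory GRing.Theory Num.Theory.
Import numFieldNormedType.Exports.

Local Open Scope classical_set_scope.
Local Open Scope ring_scope.
Local Open Scope complex_scope.

Section RiemannSphere.
Variable R : realType.

(* The topology and derivatives of the library on a field apply to terms of
   type [numFieldType]; this packing makes them available for R[i]. *)
Definition Cplx : numFieldType := R[i].

Definition sphere : Type := one_point_compactification Cplx.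

HB.instance Definition _ := Topological.on sphere.
HB.instance Definition _ := Pointed.on sphere.

(* z |-> 1/z, exchanging 0 and the point at infinity [None] *)
Definition sphere_inv (p : sphere) : sphere :=
  match p with
  | Some z => if z == 0 then None else Some z^-1
  | None => Some 0
  end.

(* An involution carrying a neighbourhood of [p] into the finite plane: the
   identity when [p] is finite, inversion when [p] is infinity. *)
Definition to_plane (p : sphere) : sphere -> sphere :=
  if p is Some _ then id else sphere_inv.

(* The value 0 at infinity is junk: in [local_rep] it is never used near the
   base point, by continuity. *)
Definition affine (p : sphere) : Cplx := if p is Some z then z else 0.

Definition chart (p q : sphere) : Cplx := affine (to_plane p q).

(* The expression of [f] in the charts at [p] and at [f p]. *)
Definition local_rep (f : sphere -> sphere) (p : sphere) : Cplx -> Cplx :=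
  fun z => chart (f p) (f (to_plane p (Some z))).

(* Derivability in direction 1, over the scalars [Cplx], is complex
   differentiability. *)
Definition holomorphic_at (f : sphere -> sphere) (p : sphere) : Prop :=
  {for p, continuous f} /\ derivable (local_rep f p) (chart p p) (1 : Cplx).

(* Since [U] is open, the value chosen off [U] is irrelevant. *)
Definition holomorphic_self_map (U : set sphere) (f : U -> U) : Prop :=
  forall p, U p -> holomorphic_at ('valL_ None (set_val \o f)) p.

End RiemannSphere.

(* Holomorphic self-maps of an open subset of the sphere (the plane, the whole
   sphere, or another open set). The set [maps] carries no topology, i.e. it is
   discrete: every subset of it counts in the ultrafilters below. *)
Record holomorphic_semigroup (R : realType) := HolomorphicSemigroup {
  domain : set (sphere R);
  domain_open : open domain;
  maps : set (domain -> domain);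
  maps_holomorphic : forall f, maps f -> holomorphic_self_map f;
  maps_comp : forall f g, maps f -> maps g -> maps (f \o g);
  maps_infinite : infinite_set maps }.

Definition element (R : realType) (S : holomorphic_semigroup R) : Type :=
  set_type (@maps R S).

Definition compose (R : realType) (S : holomorphic_semigroup R)
    (g f : element S) : element S :=
  SigSub (mem_set (maps_comp (set_valP g) (set_valP f))).

Record ultrafilter (T : Type) := Ultrafilter {
  members :> set_system T;
  members_proper : ProperFilter members;
  members_ultra : forall E : set T, members E \/ members (~` E) }.

Section Ultrafilters.
Variable T : Type.

Lemma ultrafilter_UltraFilter (F : ultrafilter T) : UltraFilter F.
Proof.
split=> [|G GP FG]; first exact: members_proper.
apply/seteqP; split=> // A GA; have [//|/FG GnA] := members_ultra F A.
exfalso; apply: (@filter_not_empty _ G GP).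
by rewrite -(setICr A); exact: filterI.
Qed.

Definition ultrafilter_of (F : set_system T) (FU : UltraFilter F) :
  ultrafilter T := Ultrafilter ultra_proper (fun A => in_ultra_setVsetC A FU).

Lemma ultrafilterP (E F : ultrafilter T) :
  (forall A, members E A <-> members F A) -> E = F.
Proof.
case: E F => [E pE uE] [F pF uF] /= EF.
have e : E = F by apply/seteqP; split=> A /EF.
by subst F; congr Ultrafilter; exact: Prop_irrelevance.
Qed.

Definition stone_basic (A : set T) : set (ultrafilter T) :=
  [set F : ultrafilter T | members F A].

HB.instance Definition _ := gen_eqMixin (ultrafilter T).
HB.instance Definition _ := gen_choiceMixin (ultrafilter T).

Let stone_cover : \bigcup_(A in [set: set T]) stone_basic A = setT.
Proof.
apply/seteqP; split=> // F _; exists setT => //.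
by have := members_proper F; rewrite /stone_basic /= => ?; exact: filterT.
Qed.

Let stone_join (A B : set T) (F : ultrafilter T) :
  [set: set T] A -> [set: set T] B -> stone_basic A F -> stone_basic B F ->
  exists C, [/\ [set: set T] C, stone_basic C F &
                stone_basic C `<=` stone_basic A `&` stone_basic B].
Proof.
move=> _ _ FA FB; exists (A `&` B); split=> //.
  by have := members_proper F => ?; exact: filterI.
move=> G GAB; have GP := members_proper G.
by split; apply: filterS GAB => x [].
Qed.

HB.instance Definition _ :=
  isBaseTopological.Build (ultrafilter T) stone_cover stone_join.

End Ultrafilters.

Section Convolution.
Variables (R : realType) (S : holomorphic_semigroup R).

Definition preshift (A : set (element S)) (f : element S) : set (element S) :=
  [set g | A (compose g f)].

Definition convolution_sets (E F : ultrafilter (element S)) :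
    set_system (element S) :=
  [set A | members F [set f | members E (preshift A f)]].

Lemma convolution_proper E F : ProperFilter (convolution_sets E F).
Proof.
have EP := members_proper E; have FP := members_proper F.
apply: Build_ProperFilter_ex => [A FA|].
  have [f Ef] := @filter_ex _ _ FP _ FA.
  have [g Ag] := @filter_ex _ _ EP _ Ef.
  by exists (compose g f).
split.
- apply: (@filterS _ F _ setT) => [f _|]; last exact: filterT.
  by apply: (@filterS _ E _ setT) => //; exact: filterT.
- move=> A B FA FB; apply: (@filterS _ F) (@filterI _ F _ _ _ FA FB).
  by move=> f [EA EB]; exact: (@filterI _ E _ _ _ EA EB).
- move=> A B AB; apply: (@filterS _ F) => f.
  by apply: (@filterS _ E) => g; exact: AB.
Qed.

Lemma convolution_ultra E F (A : set (element S)) :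
  convolution_sets E F A \/ convolution_sets E F (~` A).
Proof.
have EP := members_proper E; have FP := members_proper F.
have [FA|FnA] := members_ultra F [set f | members E (preshift A f)].
  by left.
right; apply: (@filterS _ F) FnA => f nEA.
by have [] := members_ultra E (preshift A f).
Qed.

Definition convolution (E F : ultrafilter (element S)) :
    ultrafilter (element S) :=
  Ultrafilter (convolution_proper E F) (convolution_ultra E F).

(* For [F] principal at [f], this is the extension to ultrafilters of the right
   translation [g |-> g \o f]. *)
Definition translation (F E : ultrafilter (element S)) :
    ultrafilter (element S) := convolution E F.

End Convolution.

(* Main.v *)
(* A subset [A] of the semigroup belongs to [E * F] exactly when the set of [f]
   with [preshift A f] in [E] belongs to [F], so for fixed [E] the preimage of a
   basic open set under [F |-> E * F] is again a basic open set. *)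
Require Import Defs.
From mathcomp Require Import all_boot all_order all_algebra.
From mathcomp Require Import all_classical all_reals all_analysis.

Lemma open_stone_basic (T : Type) (A : set T) : open (stone_basic A).
Proof. by exists [set A]%classic => //; rewrite bigcup_set1. Qed.

(** An open set is a union of basic sets, so one of them contains [F]. *)
Lemma nbhs_stone_basic (T : Type) (F : ultrafilter T) (U : set (ultrafilter T)) :
  nbhs F U -> exists2 A, stone_basic A F & (stone_basic A `<=` U)%classic.
Proof.
rewrite nbhsE => -[V [[D _ <-] [A DA AF]] VU].
by exists A => // G AG; apply: VU; exists A.
Qed.

(** Holds by conversion: unfolding the convolution gives membership in [F] of a set of [f] that
    depends only on [E] and [A], not on [F]. *)
Lemma preimage_translation_stone_basic (R : realType)
    (S : holomorphic_semigroup R) (E : ultrafilter (element S))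
    (A : set (element S)) :
  ((fun F => translation F E) @^-1` stone_basic A)%classic =
  stone_basic [set f | members E (preshift A f)]%classic.
Proof. by []. Qed.

Theorem theorem3p3 (R : realType) (S : holomorphic_semigroup R)
    (E : ultrafilter (element S)) :
  continuous (fun F : ultrafilter (element S) => translation F E).
Proof.
move=> F U /nbhs_stone_basic[A AF AU].
suff nbhsA : nbhs F ((fun F => translation F E) @^-1` stone_basic A)%classic.
  by apply: (@filterS _ (nbhs F)) nbhsA => G; exact: AU.
rewrite preimage_translation_stone_basic.
(* [AF] says that [A] belongs to [translation F E], which unfolds to [F] lying in the basic set now
   in the goal. *)
by apply: open_nbhs_nbhs; split; [exact: open_stone_basic | exact: AF].
Qed.
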